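(* Let $R=\{(0,0),(0,1),(2,0),(2,1),(2,2),(2,3),(3,0),(3,1),(3,3)\}$ and let $\mathrm{P}_1=(123,R)$ and $\mathrm{P}_2=(132,R)$ be mesh patterns. For every $n\ge 1$ and all integers $k,\ell\ge 0$, $$|\{\sigma\in\mathfrak{S}_n: \mathrm{P}_1(\sigma)=k,\ \mathrm{P}_2(\sigma)=\ell\}| = |\{\sigma\in\mathfrak{S}_n: \mathrm{P}_2(\sigma)=k,\ \mathrm{P}_1(\sigma)=\ell\}|.$$
   Context: $\mathfrak{S}_n$ is the set of permutations $\sigma=\sigma_1\sigma_2\cdots\sigma_n$ of $[n]=\{1,\dots,n\}$ in one-line notation. A mesh pattern is a pair $p=(\pi,R)$ with $\pi\in\mathfrak{S}_m$ and $R\subseteq\{0,\dots,m\}\times\{0,\dots,m\}$ (the set of shaded unit cells, each given by its bottom-left corner, in the grid with dots at $(i,\pi_i)$). An occurrence of $p$ in $\sigma\in\mathfrak{S}_n$ is a choice of indices $i_1<\cdots<i_m$ such that $\sigma_{i_1}\cdots\sigma_{i_m}$ is order-isomorphic to $\pi$ and, for every $(a,b)\in R$, there is no index $r$ with $i_a<r<i_{a+1}$ and $v_b<\sigma_r<v_{b+1}$; here $v_1<\cdots<v_m$ is the increasing rearrangement of $\sigma_{i_1},\dots,\sigma_{i_m}$, $i_0=v_0=0$ and $i_{m+1}=v_{m+1}=n+1$. $p(\sigma)$ denotes the number of occurrences of $p$ in $\sigma$. *)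

(* Defs.v *)
From HB Require Import structures.
From mathcomp Require Import all_boot all_order all_fingroup.

Set Implicit Arguments.
Unset Strict Implicit.
Unset Printing Implicit Defensive.

(* A permutation s : 'S_n acts on {0, ..., n-1}; the one-line entry at the
   1-based position r.+1 is (s r).+1. *)
Definition one_line n (s : 'S_n) : seq nat :=
  [seq (s r).+1 | r <- enum 'I_n].

(* A cell is named by its bottom-left corner, in {0, ..., m} x {0, ..., m}. *)
Record mesh_pattern (m : nat) := MeshPattern {
  mp_perm : 'S_m;
  mp_shading : {set 'I_m.+1 * 'I_m.+1}
}.

Section Occurrences.
Variables (m n : nat) (s : 'S_n).

(* f j is the 0-based version of the paper's index i_(j+1). *)
Implicit Type f : {ffun 'I_m -> 'I_n}.

Definition increasing f : bool :=
  [forall j : 'I_m, forall k : 'I_m, (j < k) ==> (f j < f k)].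

Definition order_isomorphic (q : 'S_m) f : bool :=
  [forall j : 'I_m, forall k : 'I_m, (s (f j) < s (f k)) == (q j < q k)].

(* The 1-based boundaries 0 = i_0 < i_1 < ... < i_m < i_(m+1) = n + 1 and
   0 = v_0 < v_1 < ... < v_m < v_(m+1) = n + 1, as sequences of size m + 2. *)
Definition pos_bounds f : seq nat :=
  0 :: rcons [seq (f j).+1 | j <- enum 'I_m] n.+1.

Definition val_bounds f : seq nat :=
  0 :: rcons (sort leq [seq (s (f j)).+1 | j <- enum 'I_m]) n.+1.

Definition in_cell f (a b : nat) (r : 'I_n) : bool :=
  (nth 0 (pos_bounds f) a < r.+1 < nth 0 (pos_bounds f) a.+1) &&
  (nth 0 (val_bounds f) b < (s r).+1 < nth 0 (val_bounds f) b.+1).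

Definition occurrence (p : mesh_pattern m) f : bool :=
  [&& increasing f,
      order_isomorphic (mp_perm p) f
    & [forall c in mp_shading p, forall r : 'I_n, ~~ in_cell f c.1 c.2 r]].

Definition occ_count (p : mesh_pattern m) : nat :=
  #|[set f | occurrence p f]|.

End Occurrences.

Definition R_shading : {set 'I_4 * 'I_4} :=
  [set c : 'I_4 * 'I_4 | (val c.1, val c.2) \in
     [:: (0, 0); (0, 1); (2, 0); (2, 1); (2, 2); (2, 3);
         (3, 0); (3, 1); (3, 3)]].

Definition perm123 : 'S_3 := 1%g.
Definition perm132 : 'S_3 :=
  tperm (Ordinal (isT : 1 < 3)) (Ordinal (isT : 2 < 3)).

Lemma one_line_perm123 : one_line perm123 = [:: 1; 2; 3].
Proof.
rewrite /one_line (eq_map (g := S \o val)) => [|i /=]; last by rewrite perm1.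
by rewrite map_comp val_enum_ord.
Qed.

Lemma one_line_perm132 : one_line perm132 = [:: 1; 3; 2].
Proof.
rewrite /one_line (eq_map (g := nth 0 [:: 1; 3; 2] \o val)) => [|i /=].
  by rewrite map_comp val_enum_ord.
by case: i => [[|[|[|i]]] Hi] //; rewrite /perm132 permE /=.
Qed.

Definition P1 : mesh_pattern 3 := MeshPattern perm123 R_shading.
Definition P2 : mesh_pattern 3 := MeshPattern perm132 R_shading.

(* Main.v *)
Require Import Defs.
From mathcomp Require Import all_boot all_order all_fingroup.
From mathcomp Require Import zify.

Set Implicit Arguments.
Unset Strict Implicit.
Unset Printing Implicit Defensive.

(** An involution of the symmetric group exchanges the two statistics.

    Look at an occurrence of either pattern, with first entry a followed by x
    and y, and let lo < hi be x and y in increasing order. The shading of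
    column 2 makes x and y adjacent, that of column 3 puts all later entries
    strictly between lo and hi, and that of column 0 puts all entries before a
    above lo. As a < lo, the last condition says that a is the first entry
    below lo, so a is determined by x and y; it exists exactly when lo is not
    the minimum of the permutation, because all the entries below lo
    precede x. Hence P1 (resp. P2) counts the adjacent ascents (resp.
    descents) x y that enclose everything after them and do not contain the
    minimum: this is [occ_count_frames].

    Such a pair lies to the right of the minimum, since every entry after the
    pair exceeds lo ([frame_after_min]). Write the
    permutation as A m B with m its minimum. Reversing the relative order
    of the values in the factor B, within the set of values of B, is an
    involution ([flipK]); it preserves enclosure and turns the ascents in B
    into descents, so it exchanges the two kinds of pairs ([frame_flip]). *)

(** * Reversing the order within a set of values *)

Section ReverseWithin.
Variables (n : nat) (B : {set 'I_n}).
Implicit Types u v : 'I_n.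

(** Outside of B the index is past the end, so the default value [v] makes
    this map the identity there. *)
Definition rev_in v : 'I_n := nth v (rev (enum B)) (index v (enum B)).

Lemma rev_in_out v : v \notin B -> rev_in v = v.
Proof.
by move=> vB; rewrite /rev_in nth_default // size_rev memNindex ?mem_enum.
Qed.

Lemma rev_in_mem v : (rev_in v \in B) = (v \in B).
Proof.
have [vB|vB] := boolP (v \in B); last by rewrite rev_in_out // (negbTE vB).
by rewrite -(mem_enum B) -mem_rev mem_nth // size_rev index_mem mem_enum.
Qed.

Lemma index_lt_size v : v \in B -> index v (enum B) < size (enum B).
Proof. by rewrite index_mem mem_enum. Qed.

Lemma index_rev_in v :
  v \in B -> index (rev_in v) (enum B) = size (enum B) - (index v (enum B)).+1.
Proof.
move=> vB; have lt_v := index_lt_size vB.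
rewrite /rev_in nth_rev // index_uniq ?enum_uniq //.
by rewrite ltn_subrL; case: (size _) lt_v.
Qed.

Lemma rev_inK : involutive rev_in.
Proof.
move=> v; have [vB|vB] := boolP (v \in B); last by rewrite !rev_in_out.
have rB : rev_in v \in B by rewrite rev_in_mem.
apply: (@index_inj _ v (enum B)); rewrite ?mem_enum ?rev_in_mem //.
by rewrite !index_rev_in //; have := index_lt_size vB; lia.
Qed.

Lemma index_enum_lt u v :
  u \in B -> v \in B -> index u (enum B) < index v (enum B) -> u < v.
Proof.
move=> uB vB; apply: (sorted_ltn_index (leT := fun u v : 'I_n => u < v));
  rewrite ?mem_enum //; first by move=> x y z; apply: ltn_trans.
rewrite /enum_mem sorted_filter //; first by move=> x y z; apply: ltn_trans.
rewrite -enumT -(sorted_map (e' := ltn) (f := val)) val_enum_ord.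
exact: iota_ltn_sorted.
Qed.

Lemma rev_in_lt u v : u \in B -> v \in B -> u < v -> rev_in v < rev_in u.
Proof.
move=> uB vB lt_uv.
apply: index_enum_lt; rewrite ?rev_in_mem // !index_rev_in //.
have lt_i : index u (enum B) < index v (enum B).
  case: ltngtP => // [/(index_enum_lt vB uB)|]; first by lia.
  move/(index_inj u (x := u)); rewrite !mem_enum => /(_ uB) eq_uv.
  by move: lt_uv; rewrite eq_uv // ltnn.
by have := index_lt_size vB; lia.
Qed.

Definition rev_perm : 'S_n := perm (inv_inj rev_inK).

End ReverseWithin.

(** * Reversing the entries that follow the minimum *)

Section Flip.
Variable n : nat.
Implicit Types s : 'S_n.+1.

Definition after_min s : {set 'I_n.+1} := [set s r | r : 'I_n.+1 & (s^-1)%g ord0 < r].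

Lemma mem_after_min s r : (s r \in after_min s) = ((s^-1)%g ord0 < r).
Proof. by rewrite mem_imset ?inE //; apply: perm_inj. Qed.

Lemma ord0_after_min s : ord0 \notin after_min s.
Proof. by rewrite -{1}(permKV s ord0) mem_after_min ltnn. Qed.

Definition flip s : 'S_n.+1 := (s * rev_perm (after_min s))%g.

Lemma flipE s r : flip s r = rev_in (after_min s) (s r).
Proof. by rewrite permM permE. Qed.

(** The minimum is not in the reversed set, so [flip] leaves it in place. With
    its position, the set of values after it is unchanged too, whence [flipK]. *)
Lemma flip_min s : ((flip s)^-1)%g ord0 = (s^-1)%g ord0.
Proof.
apply: (@perm_inj _ (flip s)); rewrite permKV flipE permKV.
by rewrite rev_in_out // ord0_after_min.
Qed.

Lemma after_min_flip s : after_min (flip s) = after_min s.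
Proof.
apply/setP=> v; rewrite -{1}(permKV (flip s) v) mem_after_min flip_min.
rewrite -mem_after_min -(rev_in_mem (after_min s) (s _)) -flipE.
by rewrite permKV.
Qed.

Lemma flipK : involutive flip.
Proof.
move=> s; apply/permP=> r.
by rewrite flipE after_min_flip flipE rev_inK.
Qed.

End Flip.

(** * Adjacent pairs that enclose the rest of the permutation *)

Section Frames.
Variable n : nat.
Implicit Types (s : 'S_n) (x : 'I_n * 'I_n).

(** For a pair [x] of positions, [low b x] is the one that should carry the
    smaller value: the first when [b] is false, as in 123, and the second when
    [b] is true, as in 132. The larger value is then at [low (~~ b) x]. *)
Definition low (b : bool) x : 'I_n := if b then x.2 else x.1.

Definition frame (b : bool) s x : bool :=
  [&& x.2 == x.1.+1 :> nat, 0 < s (low b x), s (low b x) < s (low (~~ b) x)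
    & [forall r : 'I_n, (x.2 < r) ==>
        (s (low b x) < s r < s (low (~~ b) x))]].

End Frames.

(** The minimum is neither entry of the pair, by the condition on [low b x],
    nor an entry after the pair, since those exceed the lower one. *)
Lemma frame_after_min n b (s : 'S_n.+1) x : frame b s x -> (s^-1)%g ord0 < x.1.
Proof.
case/and4P=> /eqP x2E lo_gt0 lo_lt_hi /forallP inside.
have hi_gt0 : 0 < s (low (~~ b) x) by apply: leq_trans lo_lt_hi.
rewrite ltnNge; apply/negP => le_x1.
set p := (s^-1)%g ord0 in le_x1.
have sp : s p = ord0 by rewrite permKV.
have npx (y : 'I_n.+1) : 0 < s y -> (p : nat) <> y.
  by move=> sy_gt0 /val_inj eq_py; move: sy_gt0; rewrite -eq_py sp.
have px1 : (p : nat) <> x.1 by apply: npx; case: (b) lo_gt0 hi_gt0.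
have px2 : (p : nat) <> x.2 by apply: npx; case: (b) lo_gt0 hi_gt0.
have lt_x2 : x.2 < p by lia.
by have := implyP (inside p) lt_x2; rewrite sp ltn0.
Qed.

(** The pair and all the entries after it lie in the factor on which [flip]
    reverses the order; its lower entry stays nonzero because 0 is outside. *)
Lemma frame_flip_imply n b (s : 'S_n.+1) x : frame b s x -> frame (~~ b) (flip s) x.
Proof.
move=> fr; have lt_p := frame_after_min fr.
case/and4P: fr => /eqP x2E lo_gt0 lo_lt_hi /forallP inside.
have memB (r : 'I_n.+1) : x.1 <= r -> s r \in after_min s.
  by move=> le_r; rewrite mem_after_min (leq_trans lt_p).
have lowB c : s (low c x) \in after_min s.
  by apply: memB; case: c; rewrite /= ?x2E.
apply/and4P; split.
- exact/eqP.
- rewrite lt0n flipE; apply/eqP=> /(@val_inj _ _ _ _ ord0) eq0.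
  have := lowB (~~ b); rewrite -rev_in_mem eq0.
  by rewrite (negbTE (ord0_after_min s)).
- by rewrite negbK !flipE rev_in_lt.
- apply/forallP=> r; apply/implyP=> lt_r; rewrite negbK !flipE.
  have /andP[lo_r r_hi] := implyP (inside r) lt_r.
  have rB : s r \in after_min s by apply: memB; lia.
  by rewrite !rev_in_lt.
Qed.

Lemma frame_flip n b (s : 'S_n.+1) x : frame (~~ b) (flip s) x = frame b s x.
Proof.
apply/idP/idP => [/frame_flip_imply|]; last exact: frame_flip_imply.
by rewrite flipK negbK.
Qed.

Definition pattern (b : bool) : mesh_pattern 3 := if b then P2 else P1.

(** * Occurrences of the patterns *)

Section OccurrencesAreFrames.
Variables (n : nat) (b : bool) (s : 'S_n).
Implicit Types f g : {ffun 'I_3 -> 'I_n}.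

Let i0 : 'I_3 := Ordinal (isT : 0 < 3).
Let i1 : 'I_3 := Ordinal (isT : 1 < 3).
Let i2 : 'I_3 := Ordinal (isT : 2 < 3).

Lemma forall_ord3 (P : pred 'I_3) : [forall j, P j] = [&& P i0, P i1 & P i2].
Proof.
apply/forallP/and3P => [H|[H0 H1 H2] [[|[|[|j]]] lt_j]] //.
- by rewrite (_ : Ordinal _ = i0) //; apply: val_inj.
- by rewrite (_ : Ordinal _ = i1) //; apply: val_inj.
- by rewrite (_ : Ordinal _ = i2) //; apply: val_inj.
Qed.

Lemma enum_ord3 : enum 'I_3 = [:: i0; i1; i2].
Proof. by apply: (inj_map val_inj); rewrite val_enum_ord. Qed.

Definition tail_pair f := (f i1, f i2).

(** What an occurrence says of its three positions once the shading is read: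
    [frame], with the condition that the lower entry is not the minimum
    replaced by a smaller entry [f i0] preceded only by entries above the lower
    one. *)
Definition pattern_frame f : bool :=
  let x := tail_pair f in
  [&& f i0 < f i1, x.2 == x.1.+1 :> nat,
    s (f i0) < s (low b x), s (low b x) < s (low (~~ b) x),
    [forall r : 'I_n, (r < f i0) ==> (s (low b x) < s r)]
  & [forall r : 'I_n, (x.2 < r) ==>
        (s (low b x) < s r < s (low (~~ b) x))]].

Lemma increasing3 f : increasing f = (f i0 < f i1) && (f i1 < f i2).
Proof.
rewrite /increasing !forall_ord3 /= !andbT.
by apply/idP/idP; lia.
Qed.

Lemma order_isomorphic_pattern f :
  order_isomorphic s (mp_perm (pattern b)) f =
  (s (f i0) < s (low b (tail_pair f))) &&
  (s (low b (tail_pair f)) < s (low (~~ b) (tail_pair f))).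
Proof.
rewrite /order_isomorphic !forall_ord3.
case: b => /=; rewrite ?permE /= ?perm1 ?permE /=; by apply/idP/idP; lia.
Qed.

(** The order type gives the sorted list of values without computing [sort]. *)
Lemma val_bounds_pattern f :
  s (f i0) < s (low b (tail_pair f)) ->
  s (low b (tail_pair f)) < s (low (~~ b) (tail_pair f)) ->
  val_bounds s f = [:: 0; (s (f i0)).+1; (s (low b (tail_pair f))).+1;
                     (s (low (~~ b) (tail_pair f))).+1; n.+1].
Proof.
move=> lt01 lt12; rewrite /val_bounds enum_ord3 /=.
rewrite (_ : sort _ _ = [:: (s (f i0)).+1; (s (low b (tail_pair f))).+1;
                     (s (low (~~ b) (tail_pair f))).+1]) //.
apply: (sorted_eq leq_trans anti_leq); first exact: (sort_sorted leq_total).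
  by rewrite /= !ltnS (ltnW lt01) (ltnW lt12).
rewrite perm_sort; case: (b) => //=.
by rewrite perm_cons -[[:: _; _]]/(rcons [:: _] _) perm_rcons.
Qed.

Definition R_cells : seq (nat * nat) :=
  [:: (0, 0); (0, 1); (2, 0); (2, 1); (2, 2); (2, 3); (3, 0); (3, 1); (3, 3)].

Lemma forall_R_shading (Q : nat -> nat -> bool) :
  [forall c in R_shading, Q c.1 c.2] = all (fun c => Q c.1 c.2) R_cells.
Proof.
apply/forall_inP/allP => [H [a c'] ac_in|H [a c]].
  have /andP[lt_a lt_c] : (a < 4) && (c' < 4).
    by move: (ac_in); rewrite !inE => /or4P[|||/or4P[|||/or3P[]]] /eqP[-> ->].
  by have := H (Ordinal lt_a, Ordinal lt_c); rewrite inE; apply.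
by rewrite inE => ac_in; exact: (H (val a, val c)).
Qed.

(** Every entry other than the three chosen ones lies in the interior of a row.
    So the four cells of column 2 forbid any position between [f i1] and
    [f i2], those of column 0 force entries above row 1, and those of column 3
    leave only row 2. *)
Lemma occurrence_pattern f : occurrence s (pattern b) f = pattern_frame f.
Proof.
rewrite /occurrence increasing3 order_isomorphic_pattern /pattern_frame.
have -> : mp_shading (pattern b) = R_shading by case: (b).
case lt01: (s (f i0) < _); last by rewrite !(andbF, andFb).
case lt12: (s (low b _) < _); last by rewrite !(andbF, andFb).
rewrite (forall_R_shading (fun a c => [forall r, ~~ in_cell s f a c r])).
rewrite /in_cell val_bounds_pattern // /pos_bounds enum_ord3 /=.
move: lt01 lt12; set lo := low b _; set hi := low _ _.
have s_neq (r r' : 'I_n) : (r : nat) <> r' -> (s r : nat) <> s r'.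
  by move=> neq /val_inj /perm_inj eq_r; apply: neq; rewrite eq_r.
have lo_neq (r : 'I_n) : (r : nat) <> f i1 -> (r : nat) <> f i2 ->
    (s r : nat) <> s lo /\ (s r : nat) <> s hi.
  by rewrite /lo /hi /tail_pair; case: (b) => /= ? ?; split; apply: s_neq.
move=> lt01 lt12; apply/idP/idP.
  case/andP=> /andP[lt_f01 lt_f12].
  case/andP=> /forallP c00 /andP[/forallP c01].
  case/andP=> /forallP c20 /andP[/forallP c21].
  case/andP=> /forallP c22 /andP[/forallP c23].
  case/andP=> /forallP c30 /andP[/forallP c31 /andP[/forallP c33 _]].
  apply/and4P; split=> //.
  - case: (ltngtP (f i2) (f i1).+1) => // [|lt_gap]; first by lia.
    (* The position just after [f i1] would lie in a cell of column 2. *)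
    have lt_r : (f i1).+1 < n by apply: ltn_trans (ltn_ord (f i2)).
    pose r := Ordinal lt_r.
    move: (c20 r) (c21 r) (c22 r) (c23 r) (s_neq r (f i0)) (lo_neq r).
    by have := ltn_ord (s r); move: (s r) => v /=; lia.
  - apply/forallP=> r; move: (c00 r) (c01 r).
    by have := s_neq r (f i0); have := lo_neq r; lia.
  - apply/forallP=> r; move: (c30 r) (c31 r) (c33 r).
    have := s_neq r (f i0); have := lo_neq r.
    by have := ltn_ord r; have := ltn_ord (s r); lia.
case/and4P=> lt_f01 /eqP f2E /forallP left_free /forallP inside.
rewrite lt_f01 f2E leqnn /=.
by repeat (apply/andP; split=> //); apply/forallP=> r;
  have := left_free r; have := inside r; lia.
Qed.

(** Of two distinct candidates for the first entry, the later one would be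
    preceded by the earlier one, which is below the lower entry of the pair. *)
Lemma tail_pair_inj : {in [set f | occurrence s (pattern b) f] &,
  injective tail_pair}.
Proof.
move=> f g; rewrite !inE !occurrence_pattern.
case/and5P=> f01 _ f_lo _ /andP[/forallP f_free _].
case/and5P=> g01 _ g_lo _ /andP[/forallP g_free _] eq_fg.
case: (eq_fg) => eq1 eq2.
have eq0 : f i0 = g i0.
  apply: ord_inj; case: (ltngtP (f i0) (g i0)) => // lt0.
    have := implyP (g_free _) lt0; by rewrite -eq_fg ltnNge (ltnW f_lo).
  have := implyP (f_free _) lt0; by rewrite eq_fg ltnNge (ltnW g_lo).
apply/ffunP=> j; apply/eqP; move: j; apply/forallP.
by rewrite forall_ord3 eq0 eq1 eq2 !eqxx.
Qed.

End OccurrencesAreFrames.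

(** Forgetting the first entry is injective on occurrences, and every frame is
    reached by taking for first entry the leftmost one below its lower entry;
    the minimum of the permutation shows that there is one. *)
Lemma occ_count_frames n b (s : 'S_n.+1) :
  occ_count s (pattern b) = #|[set x | frame b s x]|.
Proof.
rewrite /occ_count -(card_in_imset (@tail_pair_inj _ b s)); congr #|pred_of_set _|.
apply/setP=> x; rewrite inE; apply/imsetP/idP => [[f] | fr].
  rewrite inE occurrence_pattern => /and5P[_ x2E f_lo lo_hi /andP[_ inside]] ->.
  by rewrite /frame x2E lo_hi inside (leq_trans _ f_lo).
have lt_p := frame_after_min fr.
case/and4P: fr => /eqP x2E lo_gt0 lo_hi inside.
pose below (r : 'I_n.+1) := s r < s (low b x).
have below_p : below ((s^-1)%g ord0) by rewrite /below permKV.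
pose r0 := [arg min_(r < (s^-1)%g ord0 | below r) (r : nat)].
have [below_r0 r0_le_p r0_min] : [/\ below r0, r0 <= (s^-1)%g ord0
    & forall r, below r -> r0 <= r].
  by rewrite /r0; case: arg_minnP => // r br r_min; split=> //; apply: r_min.
pose f := [ffun j : 'I_3 => nth r0 [:: r0; x.1; x.2] j].
have fx : tail_pair f = x by rewrite /tail_pair !ffunE /=; case: (x).
exists f; rewrite ?fx // inE occurrence_pattern /pattern_frame fx !ffunE /=.
apply/and5P; split=> //; first exact: leq_ltn_trans lt_p.
  exact/eqP.
rewrite inside andbT; apply/forallP=> r; apply/implyP=> lt_r.
rewrite ltnNge leq_eqVlt negb_or; apply/andP; split; last first.
  by apply: contraTN lt_r => /r0_min; rewrite -leqNgt.
(* An entry left of [r0] is not the lower entry of the pair itself, as the pair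
   comes after the minimum and [r0] does not. *)
apply: contraTneq lt_r => /val_inj /perm_inj ->.
by rewrite -leqNgt; case: (b); rewrite /= ?x2E; lia.
Qed.

Lemma occ_count_flip n b (s : 'S_n.+1) :
  occ_count (flip s) (pattern (~~ b)) = occ_count s (pattern b).
Proof.
rewrite !occ_count_frames; congr #|pred_of_set _|.
by apply/setP=> x; rewrite !inE frame_flip.
Qed.

Theorem mainTheorem1 (n k l : nat) (hn : 1 <= n) :
  #|[set s : 'S_n | (occ_count s P1 == k) && (occ_count s P2 == l)]| =
  #|[set s : 'S_n | (occ_count s P2 == k) && (occ_count s P1 == l)]|.
Proof.
case: n hn => // n _.
rewrite -[RHS](card_preimset _ (inv_inj (@flipK n))).
congr #|pred_of_set _|; apply/setP=> s; rewrite !inE.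
by rewrite (occ_count_flip false) (occ_count_flip true).
Qed.
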